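(* Let $B$ be an elastic body which is a functionally graded solid that is relaxable, let $g$ be a material metric on $B$ whose $O(3)$-structure of $g$-orthonormal frames is integrable, and suppose that $B$ is also homosymmetric. Let $\mathcal N(B)$ be the FGM material groupoid of $B$, $\mathcal O(B)$ the orthogonal groupoid of $(B,g)$, and $\bar{\mathcal N}(B)=\{A^\perp : A\in\mathcal N(B)\}$ the set of the orthogonal parts (with respect to $g$) of the elements of $\mathcal N(B)$. Then $$\bar{\mathcal N}(B)=\mathcal N(B)\cap\mathcal O(B).$$ Therefore, fixing a frame $z$ of $T_{X_0}B$ at some $X_0\in B$ and setting $$\bar{\mathcal N}_z(B)=\{A\cdot z : A\in\bar{\mathcal N}(B),\ \alpha(A)=X_0\},\qquad \bar N_z=z^{-1}\cdot\bar{\mathcal N}(B)_{X_0,X_0}\cdot z\subset \mathrm{Gl}(3),$$ if $\bar{\mathcal N}_z(B)$ is a smooth $\bar N_z$-structure on $B$, then $B$ is homosymmetrically relaxable if and only if $\bar{\mathcal N}_z(B)$ is integrable.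
   Context: Body and constitutive law. The body $B$ is a smooth 3-dimensional manifold that can be embedded in the ambient space $\mathbb R^3$; a (local) configuration is an embedding $K$ of (an open subset $U$ of) $B$ into $\mathbb R^3$. $B$ is an elastic body, i.e. it has a constitutive law $\sigma=\sigma(F,X)$, where $X\in B$ and $F:T_XB\to\mathbb R^3$ is a linear isomorphism (deformation gradient at $X$). The symmetry group at $X$ is $\mathcal G(X)=\{P\in \mathrm{Gl}(T_XB) : \sigma(F\cdot P,X)=\sigma(F,X)\ \text{for all } F\}$. Groupoids. The frame groupoid is $\Pi(B)=\bigcup_{X,Y\in B}\mathrm{Iso}(T_XB,T_YB)$, with source $\alpha(A)=X$ and target $\beta(A)=Y$ for $A\in \mathrm{Iso}(T_XB,T_YB)$, composition of maps as composition law, and its natural smooth structure. For a subset $\Omega\subset\Pi(B)$ write $\Omega_{X,Y}=\Omega\cap \mathrm{Iso}(T_XB,T_YB)$. A subgroupoid over $B$ contains all identities and is closed under composition (when defined) and inverses; it is transitive if all $\Omega_{X,Y}\neq\emptyset$. A differential groupoid is a groupoid with smooth structures on total space and base such that source and target are smooth surjective submersions and the unit map and the composition are smooth; it is a Lie groupoid if moreover it is transitive. The FGM material groupoid is $\mathcal N(B)=\{A\in\Pi(B) : \mathcal G(Y)=A\cdot\mathcal G(X)\cdot A^{-1},\ X=\alpha(A),\ Y=\beta(A)\}$. The orthogonal groupoid $\mathcal O(B)$ of $(B,g)$ consists of all linear isometries $(T_XB,g_X)\to(T_YB,g_Y)$, $X,Y\in B$. For a linear isomorphism $F:E\to E'$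 of inner product spaces, $F^\perp$ denotes the orthogonal factor $R$ in the polar decomposition $F=R\cdot U$ ($R:E\to E'$ orthogonal, $U:E\to E$ symmetric positive definite). $G$-structures. A frame $z$ at $X$ is a basis of $T_XB$, identified with a linear isomorphism $z:\mathbb R^3\to T_XB$; $\mathcal F B$ is the frame bundle. A $G$-structure, $G$ a Lie subgroup of $\mathrm{Gl}(3)$, is a reduction of $\mathcal F B$ to the structure group $G$, i.e. an embedded submanifold of $\mathcal FB$ which is a principal $G$-bundle over $B$ for the restricted right action. A configuration $K:U\to\mathbb R^3$ induces the cross-section $X\mapsto (T_XK)^{-1}$ of $\mathcal FB$ over $U$. A $G$-structure is integrable if there is an atlas of $B$ by local configurations (charts) whose induced cross-sections take values in it. Unisymmetry. $B$ is smoothly unisymmetric if $\mathcal N(B)$ is a Lie groupoid (in particular transitive), and unisymmetric if $\mathcal N(B)$ is transitive. For $B$ smoothly unisymmetric and $z$ a frame at $X_0$, the set $\mathcal N_z(B)=\{A\cdot z: A\in\mathcal N(B),\ \alpha(A)=X_0\}$ is a $G$-structure with group $z^{-1}\mathcal N(B)_{X_0,X_0}z$, called a material $N$-structure. A unisymmetric configuration is a (local) configuration whose induced cross-section takes values in a material $N$-structure. $B$ is (globally) homosymmetric if it is smoothly unisymmetric and, for a material $N$-structure, $B$ is covered by just one unisymmetric configuration. Solids. $B$ is a functionally graded solid if there is a Riemannian metric $g$ on $B$ (a material, or solid, metric) with $\mathcal G(X)\subset O(T_XB,g_X)$ for all $X\in B$. It is relaxable if, for some material metric $g$, the $O(3)$-structure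 of $g$-orthonormal frames is integrable (equivalently, $g$ has zero Riemannian curvature); this $O(3)$-structure is then called relaxed, and a (local) configuration is called relaxed if its induced cross-section takes values in it. $B$ is homosymmetrically relaxable if it is a unisymmetric solid and $B$ is covered by local configurations that are both unisymmetric and relaxed (with respect to the relaxed $O(3)$-structure of $g$). *)

(* Defs.v *)
From HB Require Import structures.
From mathcomp Require Import all_boot all_order all_algebra.
From mathcomp Require Import all_classical all_reals all_analysis.
Import Order.TTheory GRing.Theory Num.Theory.
Import numFieldNormedType.Exports.

Set Implicit Arguments.
Unset Strict Implicit.
Unset Printing Implicit Defensive.

Local Open Scope classical_set_scope.
Local Open Scope ring_scope.

(* f is C^k on W; W is meant to be open in a finite-dimensional space, so that
   it is enough to ask for the regularity of x |-> 'd f x v for each fixed v. *)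
Fixpoint Ck (R : realType) (E F : normedModType R) (k : nat) (W : set E)
    (f : E -> F) : Prop :=
  match k with
  | 0 => forall x, W x -> {for x, continuous f}
  | k'.+1 => (forall x, W x -> differentiable f x) /\
             (forall v, Ck k' W (fun x => 'd f x v))
  end.

Definition Cinfty (R : realType) (E F : normedModType R) (W : set E)
    (f : E -> F) : Prop := forall k, Ck k W f.

Section Manifolds.
Variable R : realType.

(* [coord] is only relevant on [dom]. *)
Record chart (T : Type) (n : nat) := Chart {
  dom : set T;
  coord :> T -> 'rV[R]_n }.

Record charted (n : nat) := Charted {
  point :> Type;
  atlas : set (chart point n) }.

(* The topology induced by the atlas. *)
Definition mopen n (M : charted n) (O : set M) : Prop :=
  forall c, atlas c -> open (coord c @` (O `&` dom c)).

(* The case c = c' of [compatible] says that the image of a chart is open. *)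
Definition compatible n T (c c' : chart T n) : Prop :=
  open (coord c @` (dom c `&` dom c')) /\
  exists h : 'rV[R]_n -> 'rV[R]_n,
    Cinfty (coord c @` (dom c `&` dom c')) h /\
    forall x, dom c x -> dom c' x -> coord c' x = h (coord c x).

Definition hausdorff_charted n (M : charted n) : Prop :=
  forall x y : M, x <> y -> exists O O' : set M,
    [/\ mopen O, mopen O', O x, O' y & O `&` O' = set0].

Definition second_countable_charted n (M : charted n) : Prop :=
  exists b : nat -> set M, (forall i, mopen (b i)) /\
    forall (O : set M) x, mopen O -> O x -> exists i, b i x /\ b i `<=` O.

Definition is_manifold n (M : charted n) : Prop :=
  [/\ forall x : M, exists2 c, atlas c & dom c x,
      forall c, atlas c -> forall x y : M, dom c x -> dom c y ->
        coord c x = coord c y -> x = y,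
      forall c c', atlas c -> atlas c' -> @compatible n M c c',
      hausdorff_charted M
    & second_countable_charted M].

Definition euclid n : charted n :=
  @Charted n 'rV[R]_n [set @Chart 'rV[R]_n n setT id].

Definition prod_chart T T' m n (c : chart T m) (c' : chart T' n) :
    chart (T * T') (m + n) :=
  Chart [set p | dom c p.1 /\ dom c' p.2]
        (fun p => row_mx (coord c p.1) (coord c' p.2)).

Definition prod_charted m n (M : charted m) (N : charted n) :
    charted (m + n) :=
  @Charted (m + n) (M * N)%type
    [set e | exists c c', [/\ atlas c, atlas c' & e = prod_chart c c']].

Section SmoothMaps.
Variables (m n : nat) (M : charted m) (N : charted n).

(* h, defined near (coord c x), represents the restriction of f to S in the
   charts c around x and c' around f x. *)
Definition local_rep (S : set M) (f : M -> N) (x : M)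
    (c : chart M m) (c' : chart N n) (W : set 'rV[R]_m)
    (h : 'rV[R]_m -> 'rV[R]_n) : Prop :=
  [/\ atlas c /\ dom c x, atlas c',
      [/\ open W, W (coord c x) & W `<=` coord c @` dom c],
      Cinfty W h
    & forall y, S y -> dom c y -> W (coord c y) ->
        dom c' (f y) /\ coord c' (f y) = h (coord c y)].

(* For S not open: f extends, locally around each point of S, to a smooth map
   defined on an open set. *)
Definition smooth_on (S : set M) (f : M -> N) : Prop :=
  forall x, S x -> exists c c' W h, local_rep S f x c c' W h.

(* In the next two definitions U is meant to be open. *)
Definition immersion_on (U : set M) (f : M -> N) : Prop :=
  forall x, U x -> exists c c' W h,
    local_rep U f x c c' W h /\ injective ('d h (coord c x)).

Definition submersion_on (U : set M) (f : M -> N) : Prop :=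
  forall x, U x -> exists c c' W h,
    local_rep U f x c c' W h /\
    forall v : 'rV[R]_n, exists u, 'd h (coord c x) u = v.

Definition embedding_on (U : set M) (f : M -> N) : Prop :=
  [/\ smooth_on U f,
      immersion_on U f,
      forall x y, U x -> U y -> f x = f y -> x = y
    & forall O : set M, mopen O -> O `<=` U ->
        exists2 O' : set N, mopen O' & f @` O = f @` U `&` O'].

End SmoothMaps.

(* A candidate smooth structure of dimension k on the subset S. *)
Definition sub_charted T (S : set T) k
    (a : set (chart {x : T | S x} k)) : charted k := Charted a.

Definition incl T (S : set T) k (a : set (chart {x : T | S x} k)) :
    sub_charted a -> T := fun x => proj1_sig x.

Definition is_embedded_submanifold n (M : charted n) (S : set M) k
    (a : set (chart {x : M | S x} k)) : Prop :=
  is_manifold (sub_charted a) /\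
  @embedding_on _ _ (sub_charted a) M setT (@incl M S k a).

Record lin_iso (U V : vectType R) := LinIso {
  lmap :> 'Hom(U, V);
  lmapP : (lker lmap == 0%VS) && (limg lmap == fullv) }.

Fact id_iso_subproof (U : vectType R) :
  (lker (\1%VF : 'Hom(U, U)) == 0%VS) && (limg (\1%VF : 'Hom(U, U)) == fullv).
Proof.
rewrite lim1g eqxx andbT; apply/lker0P => x y.
by rewrite !id_lfunE.
Qed.

Definition id_iso (U : vectType R) : lin_iso U U := LinIso (id_iso_subproof U).

Fact comp_iso_subproof (U V W : vectType R) (g : lin_iso V W)
    (f : lin_iso U V) :
  (lker (g \o f)%VF == 0%VS) && (limg (g \o f)%VF == fullv).
Proof.
case: g f => [g /andP[kg /eqP ig]] [f /andP[kf /eqP if_]] /=.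
rewrite limg_comp if_ ig eqxx andbT; apply/lker0P => x y.
by rewrite !comp_lfunE => /(lker0P kg) /(lker0P kf).
Qed.

Definition comp_iso (U V W : vectType R) (g : lin_iso V W)
    (f : lin_iso U V) : lin_iso U W := LinIso (comp_iso_subproof g f).

Fact inv_iso_subproof (U V : vectType R) (f : lin_iso U V) :
  (lker (f^-1)%VF == 0%VS) && (limg (f^-1)%VF == fullv).
Proof.
case: f => [f /andP[kf /eqP imf]] /=; apply/andP; split.
  apply/lker0P => x y e.
  have xf : forall w, w \in limg f by move=> w; rewrite imf memvf.
  by rewrite -(limg_lfunVK (xf x)) e limg_lfunVK.
apply/eqP/vspaceP => x; rewrite memvf.
have -> : x = (f^-1)%VF (f x) by rewrite lker0_lfunK.
by rewrite memv_img ?memvf.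
Qed.

Definition inv_iso (U V : vectType R) (f : lin_iso U V) : lin_iso V U :=
  LinIso (inv_iso_subproof f).

(* Inner products are given by their underlying function. *)
Definition is_isometry (E E' : vectType R) (ip : E -> E -> R)
    (ip' : E' -> E' -> R) (F : lin_iso E E') : Prop :=
  forall u v, ip' (F u) (F v) = ip u v.

(* Q = F^perp, the orthogonal factor of the polar decomposition F = Q U. *)
Definition orth_part (E E' : vectType R) (ip : E -> E -> R)
    (ip' : E' -> E' -> R) (F Q : lin_iso E E') : Prop :=
  is_isometry ip ip' Q /\
  exists U : 'End(E),
    [/\ forall u v, ip (U u) v = ip u (U v),
        forall u, u != 0 -> 0 < ip (U u) u
      & lmap F = (lmap Q \o U)%VF].

(* The tangent bundle is given by its universal description: the T_x M are
   vector spaces, each chart c at x induces an isomorphism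
   [dcoord c x] = T_x c : T_x M -> R^n, and those are related by the
   differentials of the changes of charts. This determines TM up to a unique
   isomorphism. [dcoord c x] is irrelevant if c is not a chart at x. *)
Record manifold (n : nat) := Manifold {
  base_charted :> charted n;
  manifoldP : is_manifold base_charted;
  tangent : base_charted -> vectType R;
  dcoord : chart base_charted n -> forall x : base_charted,
    lin_iso (tangent x) 'rV[R]_n;
  dcoordP : forall (c c' : chart base_charted n) (x : base_charted)
      (h : 'rV[R]_n -> 'rV[R]_n),
    atlas c -> atlas c' -> dom c x -> dom c' x ->
    (forall y, dom c y -> dom c' y -> coord c' y = h (coord c y)) ->
    forall v, dcoord c' x v = 'd h (coord c x) (dcoord c x v) }.

(* D = T_x f *)
Definition is_tangent_map n (M : manifold n) m (f : M -> 'rV[R]_m) (x : M)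
    (D : 'Hom(tangent x, 'rV[R]_m)) : Prop :=
  exists c c' W h, @local_rep n m M (euclid m) setT f x c c' W h /\
    forall v, D v = 'd h (coord c x) (dcoord c x v).

Record metric n (M : manifold n) := Metric {
  ip :> forall x : M, tangent x -> tangent x -> R;
  ip_linear : forall x (a : R) u v w,
    ip (a *: u + v) w = a * ip (x := x) u w + ip v w;
  ip_sym : forall x (u v : tangent x), ip u v = ip v u;
  ip_posdef : forall x (u : tangent x), u != 0 -> 0 < ip u u;
  ip_smooth : forall (c : chart M n) (u v : 'rV[R]_n), atlas c ->
    exists h : 'rV[R]_n -> R^o, Cinfty (coord c @` dom c) h /\
      forall x, dom c x ->
        h (coord c x) = ip (inv_iso (dcoord c x) u) (inv_iso (dcoord c x) v) }.

End Manifolds.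

Arguments atlas {R n} c _.
Arguments tangent {R n} m x.
Arguments ip {R n M} m x _ _.

Notation GL3 R := (lin_iso 'rV[R]_3 'rV[R]_3).

(* The matrix of a linear map, as a point of R^(m * n). *)
Definition lin_coord (R : realType) m n (f : 'rV[R]_m -> 'rV[R]_n) :
  'rV[R]_(m * n) := mxvec (lin1_mx f).

Definition GL3_charted (R : realType) : charted R (3 * 3) :=
  @Charted R (3 * 3) (GL3 R)
    [set @Chart R (GL3 R) (3 * 3) setT (fun a => lin_coord a)].

Definition dot3 (R : realType) (u v : 'rV[R]_3) : R := (u *m v^T) 0 0.

Section LieSubgroup.
Variables (R : realType) (G : set (GL3 R)).

Definition is_subgroup : Prop :=
  [/\ G (id_iso _),
      forall a b, G a -> G b -> G (comp_iso a b)
    & forall a, G a -> G (inv_iso a)].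

(* The smooth structure [s] makes G a Lie group, immersed in GL(3). *)
Definition is_Lie_subgroup k (s : set (chart R {a | G a} k)) : Prop :=
  [/\ is_subgroup,
      is_manifold (sub_charted s),
      @immersion_on R _ _ (sub_charted s) (GL3_charted R) setT (@incl R _ G k s),
      exists mul : prod_charted (sub_charted s) (sub_charted s) -> sub_charted s,
        (forall a b, incl (mul (a, b)) = comp_iso (incl a) (incl b)) /\
        smooth_on setT mul
    & exists inv : sub_charted s -> sub_charted s,
        (forall a, incl (inv a) = inv_iso (incl a)) /\ smooth_on setT inv].

End LieSubgroup.

Section Body.
Variables (R : realType) (B : manifold R 3).
Local Notation T := (tangent B).

Record frame := Frame {
  fbase : B;
  fmap : lin_iso 'rV[R]_3 (T fbase) }.

Definition frame_chart (c : chart R B 3) : chart R frame (3 + 3 * 3) :=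
  Chart [set w | dom c (fbase w)]
    (fun w => row_mx (coord c (fbase w))
       (lin_coord (fun u => dcoord c (fbase w) (fmap w u)))).

Definition frame_bundle : charted R (3 + 3 * 3) :=
  @Charted R (3 + 3 * 3) frame [set frame_chart c | c in atlas B].

Definition frame_act (w : frame) (a : GL3 R) : frame :=
  Frame (comp_iso (fmap w) a).

(* P, with the smooth structure [p] of embedded submanifold of the frame
   bundle, is a principal bundle over B for the right action of the Lie group
   (G, s). *)
Definition is_principal (P : set frame) l (p : set (chart R {w | P w} l))
    (G : set (GL3 R)) k (s : set (chart R {a | G a} k)) : Prop :=
  [/\ @smooth_on R _ _ (sub_charted p) B setT (fun w => fbase (incl w)),
      exists act : prod_charted (sub_charted p) (sub_charted s) -> sub_charted p,
        (forall w a, incl (act (w, a)) = frame_act (incl w) (incl a)) /\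
        smooth_on setT act
    & forall X : B, exists U : set B, [/\ mopen U, U X &
        exists (phi : sub_charted p -> prod_charted B (sub_charted s))
               (psi : prod_charted B (sub_charted s) -> sub_charted p),
          [/\ smooth_on [set w : sub_charted p | U (fbase (incl w))] phi,
              smooth_on [set y : prod_charted B (sub_charted s) | U y.1] psi,
              forall w : sub_charted p, U (fbase (incl w)) ->
                (phi w).1 = fbase (incl w) /\ psi (phi w) = w,
              forall (Y : B) (a : sub_charted s), U Y ->
                phi (psi (Y, a)) = (Y, a) /\ fbase (incl (psi (Y, a))) = Y
            & forall (Y : B) (a b ab : sub_charted s), U Y -> incl ab = comp_iso (incl a) (incl b) ->
                incl (psi (Y, ab)) = frame_act (incl (psi (Y, a))) (incl b)]]].

Definition is_G_structure (P : set frame) (G : set (GL3 R)) : Prop :=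
  exists k (s : set (chart R {a | G a} k)) l (p : set (chart R {w | P w} l)),
    [/\ is_Lie_subgroup s,
        @is_embedded_submanifold R _ frame_bundle P l p
      & is_principal p s].

Definition is_config (U : set B) (K : B -> 'rV[R]_3) : Prop :=
  mopen U /\ @embedding_on R 3 3 B (euclid R 3) U K.

Definition embeddable : Prop := exists K, is_config setT K.

(* w = (T_X K)^-1, i.e., w is the value at X = fbase w of the cross-section
   induced by K; there is exactly one such w at each point where K is an
   embedding. *)
Definition induced_frame (K : B -> 'rV[R]_3) (w : frame) : Prop :=
  is_tangent_map K (lmap (inv_iso (fmap w))).

Definition section_in (U : set B) (K : B -> 'rV[R]_3) (P : set frame) : Prop :=
  forall w, U (fbase w) -> induced_frame K w -> P w.

Definition integrable_structure (P : set frame) : Prop :=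
  forall X : B, exists U K, [/\ is_config U K, U X & section_in U K P].

Definition orthonormal_frames (g : metric B) : set frame :=
  [set w | is_isometry (@dot3 R) (g (fbase w)) (fmap w)].

Record arrow := Arrow {
  src : B;
  tgt : B;
  amap : lin_iso (T src) (T tgt) }.

Definition arrow_chart (c c' : chart R B 3) :
    chart R arrow (3 + 3 + 3 * 3) :=
  Chart [set A | dom c (src A) /\ dom c' (tgt A)]
    (fun A => row_mx (row_mx (coord c (src A)) (coord c' (tgt A)))
       (lin_coord (fun u =>
          dcoord c' (tgt A) (amap A (inv_iso (dcoord c (src A)) u))))).

Definition frame_groupoid : charted R (3 + 3 + 3 * 3) :=
  @Charted R (3 + 3 + 3 * 3) arrow
    [set e | exists c c', [/\ atlas B c, atlas B c' & e = arrow_chart c c']].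

Definition hom_set (Omega : set arrow) (X Y : B) : set (lin_iso (T X) (T Y)) :=
  [set A | Omega (Arrow A)].

Definition is_subgroupoid (Omega : set arrow) : Prop :=
  [/\ forall X, hom_set Omega (id_iso (T X)),
      forall X Y Z (A : lin_iso (T X) (T Y)) (A' : lin_iso (T Y) (T Z)),
        hom_set Omega A -> hom_set Omega A' -> hom_set Omega (comp_iso A' A)
    & forall X Y (A : lin_iso (T X) (T Y)),
        hom_set Omega A -> hom_set Omega (inv_iso A)].

Definition is_transitive (Omega : set arrow) : Prop :=
  forall X Y, hom_set Omega (X := X) (Y := Y) !=set0.

(* The smooth structure [s] makes Omega a differential groupoid, embedded in
   the frame groupoid. *)
Definition is_differential_subgroupoid (Omega : set arrow) k
    (s : set (chart R {A | Omega A} k)) : Prop :=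
  let O := sub_charted s in
  [/\ is_subgroupoid Omega,
      @is_embedded_submanifold R _ frame_groupoid Omega k s,
      (@submersion_on R _ _ O B setT (fun A => src (incl A)) /\
       forall X, exists A : O, src (incl A) = X) /\
      (@submersion_on R _ _ O B setT (fun A => tgt (incl A)) /\
       forall X, exists A : O, tgt (incl A) = X),
      exists unit : B -> O,
        (forall X, incl (unit X) = Arrow (id_iso (T X))) /\
        smooth_on setT unit
    & exists mul : prod_charted O O -> O,
        (forall X Y Z (A : lin_iso (T X) (T Y)) (A' : lin_iso (T Y) (T Z))
            (p q : O), incl p = Arrow A' -> incl q = Arrow A ->
          incl (mul (p, q)) = Arrow (comp_iso A' A)) /\
        smooth_on [set pq : prod_charted O O
                  | src (incl pq.1) = tgt (incl pq.2)] mul].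

Definition is_Lie_subgroupoid (Omega : set arrow) : Prop :=
  is_transitive Omega /\
  exists k (s : set (chart R {A | Omega A} k)), is_differential_subgroupoid s.

Definition orthogonal_groupoid (g : metric B) : set arrow :=
  [set A | is_isometry (g (src A)) (g (tgt A)) (amap A)].

Definition orth_parts (g : metric B) (Omega : set arrow) : set arrow :=
  [set Q | exists2 A, hom_set Omega A &
             orth_part (g (src Q)) (g (tgt Q)) A (amap Q)].

(* {A z : A in Omega, src A = X0} *)
Definition frames_from (Omega : set arrow) (X0 : B)
    (z : lin_iso 'rV[R]_3 (T X0)) : set frame :=
  [set w | exists2 A : lin_iso (T X0) (T (fbase w)),
             hom_set Omega A & fmap w = comp_iso A z].

(* z^-1 Omega_{X0,X0} z *)
Definition conj_group (Omega : set arrow) (X0 : B)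
    (z : lin_iso 'rV[R]_3 (T X0)) : set (GL3 R) :=
  [set comp_iso (inv_iso z) (comp_iso A z)
  | A in hom_set Omega (X := X0) (Y := X0)].

Section Elastic.
(* sigma F, for F : T_X B -> R^3, is the value of the constitutive law at X;
   V is the set of values of the stress. *)
Variables (V : Type) (sigma : forall X : B, lin_iso (T X) 'rV[R]_3 -> V).

Definition symmetry_group (X : B) : set (lin_iso (T X) (T X)) :=
  [set P | forall F, sigma (comp_iso F P) = sigma F].

Definition material_groupoid : set arrow :=
  [set A | symmetry_group (X := tgt A) =
           [set comp_iso (amap A) (comp_iso P (inv_iso (amap A)))
           | P in symmetry_group (X := src A)]].

Definition unisymmetric : Prop := is_transitive material_groupoid.

Definition smoothly_unisymmetric : Prop :=
  is_Lie_subgroupoid material_groupoid.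

Definition is_material_N_structure (P : set frame) : Prop :=
  exists (X0 : B) (z : lin_iso 'rV[R]_3 (T X0)),
    P = frames_from material_groupoid z.

Definition is_unisymmetric_config (U : set B) (K : B -> 'rV[R]_3) : Prop :=
  is_config U K /\ exists2 P, is_material_N_structure P & section_in U K P.

Definition homosymmetric : Prop :=
  smoothly_unisymmetric /\ exists K, is_unisymmetric_config setT K.

Definition is_material_metric (g : metric B) : Prop :=
  forall X (P : lin_iso (T X) (T X)),
    symmetry_group P -> is_isometry (g X) (g X) P.

Definition functionally_graded_solid : Prop :=
  exists g : metric B, is_material_metric g.

Definition is_relaxed_metric (g : metric B) : Prop :=
  is_material_metric g /\ integrable_structure (orthonormal_frames g).

Definition relaxable : Prop := exists g : metric B, is_relaxed_metric g.

Definition is_relaxed_config (g : metric B) (U : set B)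
    (K : B -> 'rV[R]_3) : Prop :=
  is_config U K /\ section_in U K (orthonormal_frames g).

(* The metric is a parameter: the relaxed configurations are those of the
   relaxed O(3)-structure of the given g. *)
Definition homosymmetrically_relaxable (g : metric B) : Prop :=
  [/\ functionally_graded_solid, unisymmetric, is_relaxed_metric g
    & forall X : B, exists U K,
        [/\ U X, is_unisymmetric_config U K & is_relaxed_config g U K]].

End Elastic.
End Body.

(* Main.v *)
(** If [A = Q U] is the polar decomposition of an element of [N] and [P] is a
    material symmetry at the source of [A], then [P' = A P A^-1] is a material
    symmetry at its target, and [(P' Q) U = (Q P) (P^-1 U P)] is the same map
    decomposed twice, so [P' = Q P Q^-1]: [Q] is again in [N].

    Composing a configuration with a linear automorphism [L] of R^3 multiplies
    its induced frames by [L^-1] on the right. Given frames in [barN_z], taking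
    [L^-1 = z^-1 z'] with [z'] orthonormal makes them orthonormal while staying
    in the [N]-structure through [z']. Conversely, if the induced frames [w_Y]
    are orthonormal and lie in one [N]-structure, all [w_Y w_X^-1] lie in
    [barN], and [L^-1 = w_X^-1 Q z] with [Q] in [barN] from [X0] to [X] moves
    them to [barN_z]. *)
Require Import Defs.
From HB Require Import structures.
From mathcomp Require Import all_boot all_order all_algebra.
From mathcomp Require Import all_classical all_reals all_analysis.
Import Order.TTheory GRing.Theory Num.Theory.
Import numFieldNormedType.Exports.
Set Implicit Arguments.
Unset Strict Implicit.
Unset Printing Implicit Defensive.
Local Open Scope ring_scope.
Local Open Scope classical_set_scope.

(** * Locality of [Ck] and composition with linear maps *)

Section Smoothness.
Variable R : realType.

(** The first-order expansion of [f] at [x] is also one of [g], and such an expansion determines the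
    differential. *)
Lemma near_eq_diff (E F : normedModType R) (f g : E -> F) x :
  (\forall y \near x, f y = g y) -> differentiable f x ->
  differentiable g x /\ 'd g x = 'd f x :> (E -> F).
Proof.
move=> fg /diff_locallyP[cf /eqaddoP ef].
have eg : g \o shift x = cst (g x) + 'd f x +o_ 0 id.
  apply/eqaddoP => e e0; have := ef e e0; apply: filter_app.
  have : \forall y \near (0 : E), f (y + x) = g (y + x).
    by move: fg; rewrite (near_shift 0 x) /= subr0.
  apply: filter_app; near=> y => fgy.
  by rewrite !fctE /= fgy (nbhs_singleton fg).
have dgE := diff_unique cf eg; split => //.
by apply/diff_locallyP; rewrite dgE.
Unshelve. all: by end_near. Qed.

Lemma eq_Ck (E F : normedModType R) (W : set E) k (f g : E -> F) :
  open W -> (forall x, W x -> f x = g x) -> Ck k W f -> Ck k W g.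
Proof.
move=> oW; elim: k f g => [|k IH] f g fg /=.
  move=> cf x Wx; rewrite /prop_for /continuous_at -fg//.
  apply: cvg_trans (cf x Wx); apply: near_eq_cvg.
  by near=> y; apply: fg; near: y; exact: open_nbhs_nbhs.
have fgW x : W x -> \forall y \near x, f y = g y.
  by move=> Wx; near=> y; apply: fg; near: y; exact: open_nbhs_nbhs.
move=> [df Cf]; split=> [x Wx|v].
  by have [] := near_eq_diff (fgW x Wx) (df x Wx).
apply: IH (Cf v) => x Wx.
by have [_ ->] := near_eq_diff (fgW x Wx) (df x Wx).
Unshelve. all: by end_near. Qed.

Lemma linear_rV_continuous n (F : normedModType R)
    (L : {linear 'rV[R]_n -> F}) :
  continuous L.
Proof.
have -> : (L : _ -> _) = fun u => \sum_j u 0 j *: L (delta_mx 0 j).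
  apply/funext => u; rewrite {1}(row_sum_delta u) linear_sum.
  by apply: eq_bigr => j _; rewrite linearZ.
move=> u; have Fu : Filter (nbhs u) by exact: nbhs_filter.
apply: cvg_big => [|j _]; first exact: add_continuous.
by apply: (@cvgZr_tmp _ _ _ (nbhs u)); exact: coord_continuous.
Qed.

Lemma diff_linear_comp (E : normedModType R) n (F : normedModType R)
    (L : {linear 'rV[R]_n -> F}) (f : E -> 'rV[R]_n) x :
  differentiable f x ->
  differentiable (L \o f) x /\ 'd (L \o f) x = L \o 'd f x :> (E -> F).
Proof.
move=> df; have cL := @linear_rV_continuous _ _ L.
have dL y : differentiable L y by exact: linear_differentiable.
split; first exact: differentiable_comp.
by rewrite diff_comp// diff_lin.
Qed.

Lemma Cinfty_linear_comp (E : normedModType R) n (F : normedModType R)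
    (L : {linear 'rV[R]_n -> F}) (W : set E) (f : E -> 'rV[R]_n) :
  open W -> Cinfty W f -> Cinfty W (L \o f).
Proof.
move=> oW Cf k; have {Cf} := Cf k.
elim: k f => [|k IH] f /=.
  move=> cf x Wx; apply: continuous_comp; first exact: cf.
  exact: linear_rV_continuous.
move=> [df Cf]; split=> [x Wx|v].
  by have [] := diff_linear_comp L (df x Wx).
apply: eq_Ck oW _ (IH _ (Cf v)) => x Wx.
by have [_ ->] := diff_linear_comp L (df x Wx).
Qed.

Lemma Ck_subset (E F : normedModType R) (W W' : set E) k (f : E -> F) :
  W' `<=` W -> Ck k W f -> Ck k W' f.
Proof.
move=> sW; elim: k f => [|k IH] f /=; first by move=> cf x /sW; exact: cf.
by move=> [df Cf]; split=> [x /sW|v]; [exact: df|exact: IH].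
Qed.

End Smoothness.

(** * Algebra of linear isomorphisms, conjugation and isometries *)

Section LinearIsomorphisms.
Variable R : realType.
Implicit Types U V W : vectType R.

Lemma eq_lin_iso U V (f g : lin_iso U V) : f =1 g -> f = g.
Proof.
case: f g => [f fP] [g gP] /= /lfunP fg; move: fP gP; rewrite fg => fP gP.
by congr LinIso; exact: bool_irrelevance.
Qed.

Lemma lin_iso_inj U V (f : lin_iso U V) : injective f.
Proof. by case: f => f /= /andP[/lker0P]. Qed.

Lemma inv_isoK U V (f : lin_iso U V) : cancel f (inv_iso f).
Proof. by case: f => f /= /andP[kf _]; exact: lker0_lfunK. Qed.

Lemma inv_isoVK U V (f : lin_iso U V) : cancel (inv_iso f) f.
Proof.
by case: f => f /= /andP[_ /eqP imf] x; apply: limg_lfunVK; rewrite imf memvf.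
Qed.

Lemma comp_isoE U V W (g : lin_iso V W) (f : lin_iso U V) u :
  comp_iso g f u = g (f u).
Proof. exact: comp_lfunE. Qed.

Definition iso_simp := (comp_isoE, inv_isoK, inv_isoVK).

Lemma inv_iso_inv U V (f : lin_iso U V) : inv_iso (inv_iso f) = f.
Proof.
apply: eq_lin_iso => u; apply: (@lin_iso_inj _ _ (inv_iso f)).
by rewrite !iso_simp.
Qed.

Lemma inv_iso_comp U V W (g : lin_iso V W) (f : lin_iso U V) :
  inv_iso (comp_iso g f) = comp_iso (inv_iso f) (inv_iso g).
Proof.
apply: eq_lin_iso => u; apply: (@lin_iso_inj _ _ (comp_iso g f)).
by rewrite inv_isoVK !iso_simp.
Qed.

Lemma iso_of_inj U (f : 'End(U)) :
  injective f -> exists F : lin_iso U U, lmap F = f.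
Proof.
move=> /lker0P kf.
have fP : (lker f == 0%VS) && (limg f == fullv) by rewrite kf lker0_limgf/=.
by exists (LinIso fP).
Qed.

(** Bracketed as in [material_groupoid], so that membership there is by conversion an equation on an
    image under [conj_iso A]. *)
Definition conj_iso U V (A : lin_iso U V) (P : lin_iso U U) : lin_iso V V :=
  comp_iso A (comp_iso P (inv_iso A)).

Lemma conj_iso_comp U V W (A : lin_iso U V) (B : lin_iso V W)
    (P : lin_iso U U) :
  conj_iso (comp_iso B A) P = conj_iso B (conj_iso A P).
Proof. by apply: eq_lin_iso => u; rewrite /conj_iso inv_iso_comp !iso_simp. Qed.

Lemma conj_isoK U V (A : lin_iso U V) :
  cancel (conj_iso A) (conj_iso (inv_iso A)).
Proof.
by move=> P; apply: eq_lin_iso => u; rewrite /conj_iso inv_iso_inv !iso_simp.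
Qed.

Section Isometries.
Variables (U V W : vectType R).
Variables (ipU : U -> U -> R) (ipV : V -> V -> R) (ipW : W -> W -> R).

Lemma isometry_comp (A : lin_iso U V) (B : lin_iso V W) :
  is_isometry ipU ipV A -> is_isometry ipV ipW B ->
  is_isometry ipU ipW (comp_iso B A).
Proof. by move=> iA iB u v; rewrite !iso_simp iB iA. Qed.

Lemma isometry_inv (A : lin_iso U V) :
  is_isometry ipU ipV A -> is_isometry ipV ipU (inv_iso A).
Proof. by move=> iA u v; rewrite -iA !iso_simp. Qed.

End Isometries.

End LinearIsomorphisms.

(** * Uniqueness of the positive factor in the polar decomposition *)

Section PolarDecomposition.
Variable R : realType.

Lemma bilinear_form_inj n (A B : 'M[R]_n) :
  (forall u v : 'rV_n, (u *m A *m v^T) 0 0 = (u *m B *m v^T) 0 0) -> A = B.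
Proof.
move=> AB; apply/matrixP => i j; have := AB (delta_mx 0 i) (delta_mx 0 j).
by rewrite -!rowE trmx_delta -!colE !mxE.
Qed.

(** The trace is the sum of [r M r^T] over the rows [r] of [D]; each term is nonnegative and
    vanishes only for [r = 0]. *)
Lemma trace_congr_ge0 n (D M : 'M[R]_n) :
  (forall u : 'rV_n, u != 0 -> 0 < (u *m M *m u^T) 0 0) ->
  0 <= \tr (D *m M *m D^T) ?= iff (D == 0).
Proof.
move=> M0.
have trE : \tr (D *m M *m D^T) = \sum_i (row i D *m M *m (row i D)^T) 0 0.
  apply: eq_bigr => i _; rewrite tr_row -!row_mul !mxE.
  by apply: eq_bigr => j _; rewrite !mxE.
have ge0 (u : 'rV_n) : 0 <= (u *m M *m u^T) 0 0.
  by have [->|/M0/ltW//] := eqVneq u 0; rewrite !mul0mx mxE.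
split; first by rewrite trE sumr_ge0.
rewrite trE eq_sym; apply/eqP/eqP => [/eqP|->]; last first.
  by apply: big1 => i _; rewrite row0 !mul0mx mxE.
rewrite psumr_eq0// => /allP D0; apply/row_matrixP => i; rewrite row0.
apply/eqP/negPn/negP => /M0; rewrite lt_neqAle eq_sym.
by have /eqP-> := D0 i (mem_index_enum i); rewrite eqxx.
Qed.

(* With [D = M - N], [M^2 = N^2] gives [M D + D N = 0]; multiplying by [D] and
   taking traces, [tr (D M D) + tr (D N D) = 0], a sum of nonnegative terms. *)
Lemma posdef_sqrt_unique n (M N : 'M[R]_n) :
  M^T = M -> N^T = N ->
  (forall u : 'rV_n, u != 0 -> 0 < (u *m M *m u^T) 0 0) ->
  (forall u : 'rV_n, u != 0 -> 0 < (u *m N *m u^T) 0 0) ->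
  M *m M = N *m N -> M = N.
Proof.
move=> sM sN pM pN MN; apply/eqP; rewrite -subr_eq0; set D := M - N.
have sD : D^T = D by rewrite /D linearB /= sM sN.
have [ge0M eM] := trace_congr_ge0 D pM; have [ge0N _] := trace_congr_ge0 D pN.
have e : M *m D + D *m N = 0.
  by rewrite mulmxBr mulmxBl MN addrC addrA subrK subrr.
have : \tr (D *m M *m D^T) + \tr (D *m N *m D^T) = 0.
  by rewrite sD (mxtrace_mulC (D *m N)) -(mulmxA D M) -mxtraceD
    -mulmxDr e mulmx0 mxtrace0.
move/eqP; rewrite paddr_eq0// => /andP[/eqP tr0 _].
by rewrite -eM tr0.
Qed.

(** Isometries preserve inner products, so [ip (U u) (U v) = ip (U' u) (U' v)], that is [U^2 = U'^2]
    by symmetry. The orthonormal frame [w] turns [U] and [U'] into symmetric positive definite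
    matrices, where square roots are unique. *)
Lemma polar_unique (E E' : vectType R) (ip : E -> E -> R) (ip' : E' -> E' -> R)
    (w : lin_iso 'rV[R]_3 E) (Q Q' : lin_iso E E') (U U' : 'End(E)) :
  is_isometry (@dot3 R) ip w ->
  is_isometry ip ip' Q -> is_isometry ip ip' Q' ->
  (forall u v, ip (U u) v = ip u (U v)) ->
  (forall u v, ip (U' u) v = ip u (U' v)) ->
  (forall u, u != 0 -> 0 < ip (U u) u) ->
  (forall u, u != 0 -> 0 < ip (U' u) u) ->
  (forall u, Q (U u) = Q' (U' u)) -> U = U'.
Proof.
move=> iw iQ iQ' sU sU' pU pU' QU.
pose mx (S : 'End(E)) := lin1_mx (inv_iso w \o S \o w)%VF.
have mxE S u : u *m mx S = inv_iso w (S (w u)).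
  by rewrite mul_rV_lin1 /= !comp_lfunE.
have ipE u v : dot3 u v = ip (w u) (w v) by rewrite iw.
have symP (S : 'End(E)) : (forall u v, ip (S u) v = ip u (S v)) ->
    (mx S)^T = mx S.
  move=> sS; apply: bilinear_form_inj => u v.
  rewrite -mulmxA -trmx_mul -/(dot3 u (v *m mx S)) -/(dot3 (u *m mx S) v).
  by rewrite !ipE !mxE !inv_isoVK sS.
have posP (S : 'End(E)) : (forall u, u != 0 -> 0 < ip (S u) u) ->
    forall u : 'rV_3, u != 0 -> 0 < (u *m mx S *m u^T) 0 0.
  move=> pS u u0; rewrite -/(dot3 (u *m mx S) u) ipE mxE inv_isoVK; apply: pS.
  apply: contra_neq u0 => wu0.
  by apply: (@lin_iso_inj _ _ _ w); rewrite wu0 linear0.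
have sqE (S : 'End(E)) (u v : 'rV_3) : (mx S)^T = mx S ->
    (u *m (mx S *m mx S) *m v^T) 0 0 = ip (S (w u)) (S (w v)).
  move=> sS; rewrite mulmxA -mulmxA -{2}sS -trmx_mul.
  by rewrite -/(dot3 (u *m mx S) (v *m mx S)) ipE !mxE !inv_isoVK.
have : mx U = mx U'.
  apply: posdef_sqrt_unique; [exact: symP|exact: symP|exact: posP|exact: posP|].
  by apply: bilinear_form_inj => u v; rewrite !sqE ?symP// -iQ -iQ' !QU.
move=> e; apply/lfunP => u; rewrite -(inv_isoVK w u).
apply: (@lin_iso_inj _ _ _ (inv_iso w)).
by rewrite -!mxE e.
Qed.

End PolarDecomposition.

(** * Configurations followed by a linear automorphism, and their induced frames *)

Section Configurations.
Variables (R : realType) (B : manifold R 3).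
Implicit Types (K : B -> 'rV[R]_3) (L : GL3 R) (w : frame B).

(** The only chart of [euclid] is the identity with full domain, so the charts and [W] can be kept
    and only the representative changes. *)
Lemma local_rep_comp L (S : set B) K x (c : chart R B 3)
    (c' : chart R (euclid R 3) 3) W h :
  @local_rep R 3 3 B (euclid R 3) S K x c c' W h ->
  @local_rep R 3 3 B (euclid R 3) S (L \o K) x c c' W (L \o h).
Proof.
move=> [acx ac' [oW Wx sW] Ch Kh]; split => //; first exact: Cinfty_linear_comp.
move: ac' Kh; rewrite /atlas /= => -> Kh y Sy cy Wy.
by have [_ <-] := Kh y Sy cy Wy.
Qed.

Lemma local_rep_diff_comp L (S : set B) K x (c : chart R B 3)
    (c' : chart R (euclid R 3) 3) W h u :
  @local_rep R 3 3 B (euclid R 3) S K x c c' W h ->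
  'd (L \o h) (c x) u = L ('d h (c x) u).
Proof.
move=> [_ _ [_ Wx _] /(_ 1%N)[dh _] _].
pose L' : {linear 'rV[R]_3 -> 'rV[R]_3} := fun_of_lfun (lmap L).
have [_ dL] := diff_linear_comp L' (dh _ Wx).
exact: (congr1 (fun k => k u) dL).
Qed.

Lemma is_config_comp L (U : set B) K : is_config U K -> is_config U (L \o K).
Proof.
move=> [oU [sK iK jK hK]]; split => //; split.
- move=> x /sK[c [c' [W [h rep]]]]; exists c, c', W, (L \o h).
  exact: local_rep_comp.
- move=> x /iK[c [c' [W [h [rep inj]]]]]; exists c, c', W, (L \o h).
  split; first exact: local_rep_comp.
  move=> u v uv; apply/inj/(@lin_iso_inj _ _ _ L).
  by rewrite -!(local_rep_diff_comp L _ rep).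
- by move=> x y Ux Uy /lin_iso_inj; exact: jK.
- move=> O openO sO; have [Z openZ KO] := hK O openO sO.
  exists (L @` Z); last first.
    rewrite (_ : (L \o K) @` O = L @` (K @` O)); last by rewrite image_comp.
    rewrite KO (_ : (L \o K) @` U = L @` (K @` U)); last by rewrite image_comp.
    apply/seteqP; split=> [_ [y [yU yO] <-]|_ [[y yU <-] [z zO]]].
      by split; exists y.
    by move=> /lin_iso_inj zy; exists y => //; split => //; rewrite -zy.
  (* In the identity chart [mopen] is ordinary openness, and the image under [L] is the preimage
     under its continuous inverse. *)
  move=> _ ->; have := openZ _ (erefl _); rewrite /= !setIT !image_id => openZ'.
  rewrite (_ : L @` Z = inv_iso L @^-1` Z).
    apply: open_comp => // u _; exact: linear_rV_continuous.
  apply/seteqP; split=> [_ [y Zy <-]|y Zy] /=; first by rewrite inv_isoK.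
  by exists (inv_iso L y); rewrite ?inv_isoVK.
Qed.

Lemma is_tangent_map_comp L K (x : B) (D D' : 'Hom(tangent B x, 'rV[R]_3)) :
  (forall v, D' v = L (D v)) -> is_tangent_map K D ->
  is_tangent_map (L \o K) D'.
Proof.
move=> D'E [c [c' [W [h [rep DE]]]]]; exists c, c', W, (L \o h).
split; first exact: local_rep_comp.
by move=> v; rewrite (local_rep_diff_comp L _ rep) D'E DE.
Qed.

(** If [w = (T (L K))^-1 = (T K)^-1 L^-1], then [w L = (T K)^-1]; this is the chain rule for
    [K = L^-1 (L K)]. *)
Lemma induced_frame_comp L K w :
  induced_frame (L \o K) w -> induced_frame K (frame_act w L).
Proof.
rewrite {2}(_ : K = inv_iso L \o (L \o K)); last first.
  by apply/funext => y /=; rewrite inv_isoK.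
apply: is_tangent_map_comp => v.
by rewrite -[Defs.fmap _]/(comp_iso (Defs.fmap w) L) inv_iso_comp comp_isoE.
Qed.

Lemma exists_induced_frame (U : set B) K (x : B) : is_config U K -> U x ->
  exists z : lin_iso 'rV[R]_3 (tangent B x), induced_frame K (Frame z).
Proof.
move=> [oU [_ iK _ _]] Ux; have [c [c' [W [h [rep inj]]]]] := iK x Ux.
have [[ac cx] ac' [oW Wx sW] Ch Kh] := rep.
(* The differential is injective between spaces of equal dimension, hence invertible. *)
have [F FE] : exists F : GL3 R, forall u, F u = 'd h (c x) u.
  have [|F FE] := @iso_of_inj R _ (linfun ('d h (c x))).
    by move=> u v; rewrite !lfunE; exact: inj.
  by exists F => u; rewrite FE lfunE.
exists (inv_iso (comp_iso F (dcoord c x))).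
(* The representative is only valid at points of [U], while [is_tangent_map] wants it at all points
   of the chart over [W]. Shrinking [W] to the image of [U] suffices, since charts are injective. *)
exists c, c', (W `&` c @` (U `&` dom c)), h; split; last first.
  move=> v; rewrite -[Defs.fmap _]/(inv_iso (comp_iso F (dcoord c x))).
  by rewrite inv_iso_inv comp_isoE FE.
split => //.
- split; first by apply: openI => //; exact: oU.
    by split => //; exists x.
  by move=> y [/sW].
- by move=> k; apply: Ck_subset (Ch k) => y [].
- move=> y _ cy [Wy [y' [Uy' cy'] yy']].
  have [_ charts_inj _ _ _] := manifoldP B.
  by apply: Kh => //; rewrite -(charts_inj c ac _ _ cy' cy yy').
Qed.

(** Integrability supplies a configuration around [x] whose induced frame at [x] is orthonormal. *)
Lemma exists_orthonormal_frame (g : metric B) (x : B) :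
  integrable_structure (orthonormal_frames g) ->
  exists z : lin_iso 'rV[R]_3 (tangent B x), is_isometry (@dot3 R) (g x) z.
Proof.
move=> /(_ x)[U [K [cK Ux sK]]]; have [z zK] := exists_induced_frame cK Ux.
by exists z; exact: (sK (Frame z)).
Qed.

End Configurations.

(** * The material groupoid, its orthogonal parts and the frames they generate *)

Section MaterialGroupoid.
Variables (R : realType) (B : manifold R 3) (V : Type).
Variable sigma : forall X : B, lin_iso (tangent B X) 'rV[R]_3 -> V.
Variable g : metric B.
Local Notation N := (material_groupoid sigma).
Local Notation barN := (orth_parts g N).

Lemma material_homE X Y (A : lin_iso (tangent B X) (tangent B Y)) :
  hom_set N A = (symmetry_group sigma (X := Y) =
                 conj_iso A @` symmetry_group sigma (X := X)).
Proof. by []. Qed.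

Lemma material_comp X Y Z (A : lin_iso (tangent B X) (tangent B Y))
    (A' : lin_iso (tangent B Y) (tangent B Z)) :
  hom_set N A -> hom_set N A' -> hom_set N (comp_iso A' A).
Proof.
rewrite !material_homE => GY ->; rewrite GY image_comp.
by apply: eq_imagel => P _ /=; rewrite conj_iso_comp.
Qed.

Lemma material_inv X Y (A : lin_iso (tangent B X) (tangent B Y)) :
  hom_set N A -> hom_set N (inv_iso A).
Proof.
rewrite !material_homE => ->; rewrite image_comp.
under eq_imagel do rewrite /= conj_isoK.
by rewrite image_id.
Qed.

Lemma material_orth_part X Y (A Q : lin_iso (tangent B X) (tangent B Y)) :
  is_relaxed_metric sigma g -> hom_set N A -> orth_part (g X) (g Y) A Q ->
  hom_set N Q.
Proof.
move=> [gG /exists_orthonormal_frame] /(_ X)[w iw].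
rewrite !material_homE => GY [iQ [U [sU pU AQU]]]; rewrite {1}GY.
have AE u : A u = Q (U u) by rewrite AQU comp_lfunE.
(* It is enough that conjugation by [A] and by [Q] agree on each material symmetry [P]. *)
apply: eq_imagel => P PG; set P' := conj_iso A P.
have iP := gG _ _ PG.
have iP' : is_isometry (g Y) (g Y) P' by apply: gG; rewrite GY; exists P.
have PA u : P' (A u) = A (P u) by rewrite /P' /conj_iso !iso_simp.
have iPV := isometry_inv iP.
(* [U'] is again symmetric and positive definite because [P] is an isometry. *)
pose U' := (inv_iso P \o U \o P)%VF.
have U'E u : U' u = inv_iso P (U (P u)) by rewrite !comp_lfunE.
have UU' : U = U'.
  apply: (polar_unique (Q := comp_iso P' Q) (Q' := comp_iso Q P) iw) => //.
  - exact: isometry_comp iP'.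
  - exact: isometry_comp iQ.
  - by move=> u v; rewrite !U'E -iP -[RHS]iP !inv_isoVK sU.
  - move=> u u0; rewrite U'E -iP inv_isoVK; apply: pU.
    apply: contra_neq u0 => Pu0.
    by apply: (@lin_iso_inj _ _ _ P); rewrite Pu0 linear0.
  - by move=> u; rewrite (comp_isoE P' Q) (comp_isoE Q P) U'E inv_isoVK -!AE PA.
have UP u : P (U u) = U (P u) by rewrite {1}UU' U'E inv_isoVK.
(* With [y = A u = Q (U u)]: [P' y = A (P u) = Q (U (P u)) = Q (P (U u))], which is [Q P Q^-1] at
   [y]. *)
apply: eq_lin_iso => y; rewrite -(inv_isoVK A y) PA !AE /conj_iso 2!comp_isoE.
by rewrite inv_isoK UP.
Qed.

Lemma orth_parts_material :
  is_relaxed_metric sigma g -> barN = N `&` orthogonal_groupoid g.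
Proof.
move=> gN; apply/seteqP; split=> [[X Y Q] [A AN AQ]|[X Y Q] [QN iQ]].
  by split; [exact: material_orth_part AQ|case: AQ].
(* An isometry is its own orthogonal part, with identity positive factor. *)
exists Q => //; split => //; exists \1%VF; split=> [u v|u u0|].
- by rewrite !id_lfunE.
- by rewrite id_lfunE; exact: ip_posdef.
- by rewrite comp_lfun1r.
Qed.

(** For [w = A z1] and [w' = A' z1] the reference frame cancels, leaving [A' A^-1]. *)
Lemma material_frames_comp X1 (z1 : lin_iso 'rV[R]_3 (tangent B X1))
    (w w' : frame B) :
  frames_from N z1 w -> frames_from N z1 w' ->
  hom_set N (comp_iso (Defs.fmap w') (inv_iso (Defs.fmap w))).
Proof.
move=> [A AN wE] [A' AN' wE'].
have -> : comp_iso (Defs.fmap w') (inv_iso (Defs.fmap w)) =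
    comp_iso A' (inv_iso A).
  by apply: eq_lin_iso => u; rewrite wE wE' inv_iso_comp !comp_isoE inv_isoVK.
by apply: material_comp => //; exact: material_inv.
Qed.

(** A local trivialization around [X], evaluated at [X] and the identity of the group, yields a
    frame at [X] in the structure, hence an arrow from [X0] to [X]. *)
Lemma G_structure_frames_from (Omega : set (arrow B)) X0
    (z : lin_iso 'rV[R]_3 (tangent B X0)) X :
  is_G_structure (frames_from Omega z) (conj_group Omega z) ->
  exists Q : lin_iso (tangent B X0) (tangent B X), hom_set Omega Q.
Proof.
move=> [k [s [l [p [[[G1 _ _] _ _ _ _] _ [_ _ /(_ X)]]]]]].
move=> [U [_ UX [phi [psi [_ _ _ /(_ X (exist _ _ G1) UX)[_ <-] _]]]]].
by have [Q QO _] := proj2_sig (psi (X, exist _ _ G1)); exists Q.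
Qed.

End MaterialGroupoid.

Theorem theorem6p8 (R : realType) (B : manifold R 3) (V : Type)
    (sigma : forall X : B, lin_iso (tangent B X) 'rV[R]_3 -> V) (g : metric B) :
  embeddable B ->
  functionally_graded_solid sigma ->
  relaxable sigma ->
  is_relaxed_metric sigma g ->
  homosymmetric sigma ->
  let N := material_groupoid sigma in
  let barN := orth_parts g N in
  barN = N `&` orthogonal_groupoid g /\
  forall (X0 : B) (z : lin_iso 'rV[R]_3 (tangent B X0)),
    is_G_structure (frames_from barN z) (conj_group barN z) ->
    (homosymmetrically_relaxable sigma g <->
     integrable_structure (frames_from barN z)).
Proof.
move=> _ gS _ gR [[uN _] _] N barN.
have barNE : barN = N `&` orthogonal_groupoid g by exact: orth_parts_material.
split=> // X0 z Gz; split.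
- move=> [_ _ _ cover] X.
  have [U [K [UX [cK [P [X1 [z1 ->]] KN]] [_ KO]]]] := cover X.
  have [wX KwX] := exists_induced_frame cK UX.
  have [Q Qbar] := G_structure_frames_from X Gz.
  have [QN QO] : (N `&` orthogonal_groupoid g) (Arrow Q) by rewrite -barNE.
  pose L := comp_iso (inv_iso (comp_iso Q z)) wX.
  exists U, (L \o K); split=> //; first exact: is_config_comp.
  move=> w Uw /induced_frame_comp Kw.
  have wN := KN (frame_act w L) Uw Kw; have wO := KO (frame_act w L) Uw Kw.
  (* [C] carries [wX] to [w L]; as [L wX^-1 = (Q z)^-1], it follows that [w = C Q z]. *)
  pose C := comp_iso (comp_iso (Defs.fmap w) L) (inv_iso wX).
  have CN : hom_set N C := material_frames_comp (KN (Frame wX) UX KwX) wN.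
  have CO : is_isometry (g X) (g (fbase w)) C.
    exact: isometry_comp (isometry_inv (KO (Frame wX) UX KwX)) wO.
  exists (comp_iso C Q).
    rewrite /hom_set /mkset barNE; split; first exact: material_comp CN.
    exact: isometry_comp CO.
  apply: eq_lin_iso => u; rewrite /C /L !comp_isoE inv_isoVK.
  by rewrite -(comp_isoE Q z) inv_isoK.
- move=> intz; split=> // X; have [U [K [cK UX Kbar]]] := intz X.
  have [z' z'O] := exists_orthonormal_frame X0 gR.2.
  pose L := comp_iso (inv_iso z') z.
  (* From [w L = Q z] and [L = z'^-1 z] one gets [w = Q z']. *)
  have framesP w : U (fbase w) -> induced_frame (L \o K) w ->
      exists2 Q : lin_iso (tangent B X0) (tangent B (fbase w)),
        hom_set barN Q & Defs.fmap w = comp_iso Q z'.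
    move=> Uw /induced_frame_comp Kw.
    have [Q Qbar QE] := Kbar (frame_act w L) Uw Kw; exists Q => //.
    have {}QE : comp_iso (Defs.fmap w) L = comp_iso Q z := QE.
    apply: eq_lin_iso => u; rewrite comp_isoE.
    rewrite -(inv_isoVK z (z' u)) -(comp_isoE Q z).
    by rewrite -QE /L !comp_isoE inv_isoVK inv_isoK.
  have cLK : is_config U (L \o K) by exact: is_config_comp.
  (* [Q] serves twice: as an element of [N] it puts [w] in the structure through [z'], and as an
     isometry it makes [w = Q z'] orthonormal. *)
  exists U, (L \o K); split=> //; split=> //.
    exists (frames_from N z'); first by exists X0, z'.
    move=> w Uw /(framesP _ Uw)[Q]; rewrite barNE => -[QN _] QE.
    by exists Q.
  move=> w Uw /(framesP _ Uw)[Q]; rewrite barNE => -[_ QO] QE.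
  by rewrite /orthonormal_frames /mkset QE; exact: isometry_comp QO.
Qed.
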